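(* Let $K$ be a finite extension of $K_0=\mathbb{F}_q(T)$, and let $\phi,\psi$ be isogenous Drinfeld modules defined over $K$. For any finite place $v$ of $K$, $\phi$ has stable reduction at $v$ if and only if $\psi$ has stable reduction at $v$.
   Context: $\mathbb{F}_q$ is a finite field with $q$ elements, $A=\mathbb{F}_q[T]$. $K\{\tau\}$ is the ring of twisted polynomials $\sum_i f_i\tau^i$ ($f_i\in K$) with $\tau c=c^q\tau$ for $c\in K$. A Drinfeld module of rank $r\geqslant1$ over $K$ is an $\mathbb{F}_q$-algebra homomorphism $\phi:A\to K\{\tau\}$, $a\mapsto\phi_a$, such that for every $a\in A$ the constant coefficient of $\phi_a$ is $a$, and $\deg_\tau\phi_a=r\deg_T a$. Two Drinfeld modules $\phi,\psi$ over $K$ are isogenous if there is an isogeny $f:\phi\to\psi$, i.e. a nonzero $f\in K\{\tau\}$ with $f\cdot\phi_a=\psi_a\cdot f$ for all $a\in A$ (they then have the same rank). Each place $v$ of $K$ gives a valuation $\mathrm{ord}_v:K\to\mathbb{Z}\cup\{\infty\}$ normalized by $\mathrm{ord}_v(K^* )=\mathbb{Z}$. A place of $K$ is infinite if it lies above the place $\infty$ of $K_0$ (given by $\mathrm{ord}_\infty(a)=-\deg a$ for $a\in A$), and finite otherwise. A Drinfeld module $\phi$ of rank $r$ over $K$ has stable reduction at $v$ if there is $c\in K^*$ such that, writing $c^{-1}\cdot\phi_T\cdot c=T+\sum_{i=1}^r g_i\tau^i$ with $g_i\in K$, one has $\min\{\mathrm{ord}_v(g_i):1\leqslant i\leqslant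 r\}=0$. *)

(* Defs.v *)
From HB Require Import structures.
From mathcomp Require Import all_boot all_order all_algebra all_field.
From mathcomp Require Import constructive_ereal.
From mathcomp Require Import zify.

Set Implicit Arguments.
Unset Strict Implicit.
Unset Printing Implicit Defensive.

Import Order.TTheory GRing.Theory Num.Theory.
Local Open Scope ring_scope.

(* Throughout, F is the finite field F_q (so q = #|F|), A = F_q[T] is {poly F},
   K_0 = F_q(T) is {fraction {poly F}}, and a finite extension K of K_0 is a
   fieldExtType over {fraction {poly F}}. *)

Section Twisted.

Variables (F : finFieldType) (K : fieldExtType {fraction {poly F}}).

Definition embA (a : {poly F}) : K := (FracField.tofrac a)%:A.

Lemma embA_is_zmod_morphism : zmod_morphism embA.
Proof. by move=> a b; rewrite /embA rmorphB scalerBl. Qed.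

Lemma embA_is_monoid_morphism : monoid_morphism embA.
Proof.
split; first by rewrite /embA rmorph1 scale1r.
by move=> a b; rewrite /embA rmorphM -scalerAl mul1r scalerA.
Qed.

HB.instance Definition _ :=
  GRing.isZmodMorphism.Build {poly F} K embA embA_is_zmod_morphism.
HB.instance Definition _ :=
  GRing.isMonoidMorphism.Build {poly F} K embA embA_is_monoid_morphism.

Lemma embA_eq0 a : (embA a == 0) = (a == 0).
Proof. by rewrite /embA scaler_eq0 oner_eq0 orbF tofrac_eq0. Qed.

(* The twisted polynomial sum_i f_i tau^i is represented by the ordinary
   polynomial with the same coefficients; tpoly is an alias of {poly K}, so as
   to carry a different multiplication. *)
Definition tpoly : Type := {poly K}.

Implicit Types f g h : tpoly.

Definition tcoef f (i : nat) : K := (f : {poly K})`_i.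

(* 0 when f = 0 *)
Definition tdeg f : nat := (size (f : {poly K})).-1.

Definition tconst (c : K) : tpoly := c%:P.

HB.instance Definition _ := GRing.Zmodule.copy tpoly {poly K}.

Lemma tcoefP f g : tcoef f =1 tcoef g <-> f = g.
Proof. by split=> [h|-> //]; apply/polyP. Qed.

Lemma tcoefD f g i : tcoef (f + g) i = tcoef f i + tcoef g i.
Proof. exact: coefD. Qed.

Lemma tcoefC c i : tcoef (tconst c) i = if i == 0%N then c else 0.
Proof. exact: coefC. Qed.

(* tau c = c^q tau, hence (a tau^j) (b tau^k) = a b^(q^j) tau^(j+k). *)
Definition tmul f g : tpoly :=
  \poly_(i < (size (f : {poly K}) + size (g : {poly K})).-1)
     (\sum_(j < i.+1) tcoef f j * tcoef g (i - j) ^+ (#|F| ^ j)).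

Lemma expq_gt0 j : (0 < #|F| ^ j)%N.
Proof. by rewrite expn_gt0 (ltnW (finNzRing_gt1 F)). Qed.

Lemma expr0q j : (0 : K) ^+ (#|F| ^ j) = 0.
Proof. by rewrite expr0n eqn0Ngt expq_gt0. Qed.

Lemma q_pchar_nat j : [pchar K].-nat (#|F| ^ j)%N.
Proof.
have [p pr_p pF] := finPcharP F.
have pK : p \in [pchar K].
  by apply: (rmorph_pchar embA); apply: (rmorph_pchar (@polyC F)).
rewrite (card_pprimeChar pF) -expnM pnatX; apply/orP; left.
by rewrite pnatE.
Qed.

Lemma exprDq (x y : K) j :
  (x + y) ^+ (#|F| ^ j) = x ^+ (#|F| ^ j) + y ^+ (#|F| ^ j).
Proof. exact/exprDn_pchar/q_pchar_nat. Qed.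

Lemma expr_sumq n (P : pred 'I_n) (u : 'I_n -> K) j :
  (\sum_(i < n | P i) u i) ^+ (#|F| ^ j)
    = \sum_(i < n | P i) u i ^+ (#|F| ^ j).
Proof.
apply: (big_morph (fun x : K => x ^+ (#|F| ^ j))) => [x y|].
  exact: exprDq.
exact: expr0q.
Qed.

Lemma tcoefM f g i :
  tcoef (tmul f g) i
    = \sum_(j < i.+1) tcoef f j * tcoef g (i - j) ^+ (#|F| ^ j).
Proof.
rewrite /tmul [LHS]coef_poly ltn_predRL; case: leqP => // le_pq_i1.
rewrite big1 // => j _; rewrite /tcoef.
have [lq_p_j|lt_j_p] := leqP (size (f : {poly K})) j.
  by rewrite nth_default ?mul0r.
rewrite [(g : {poly K})`__]nth_default ?expr0q ?mulr0 // leq_subRL -ltnS //.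
by rewrite (leq_trans _ le_pq_i1) // ltn_add2r.
Qed.

Lemma tcoefMr f g i :
  tcoef (tmul f g) i
    = \sum_(j < i.+1) tcoef f (i - j) * tcoef g j ^+ (#|F| ^ (i - j)).
Proof.
rewrite tcoefM (reindex_inj rev_ord_inj) /=.
by apply: eq_bigr => j _; rewrite subSS (sub_ordK j).
Qed.

Lemma tmulA : associative tmul.
Proof.
move=> f g h; apply/tcoefP => i; rewrite tcoefM tcoefMr.
pose coef3 j k := tcoef f j *
  (tcoef g (i - j - k) ^+ (#|F| ^ j) * tcoef h k ^+ (#|F| ^ (i - k))).
transitivity (\sum_(j < i.+1) \sum_(k < i.+1 | (k <= i - j)%N) coef3 j k).
  apply: eq_bigr => /= j _; rewrite tcoefMr expr_sumq big_distrr /=.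
  rewrite (big_ord_narrow_leq (leq_subr _ _)); apply: eq_bigr => k _ /=.
  rewrite /coef3 exprMn -exprM -expnD; congr (_ * (_ * _ ^+ (_ ^ _))).
  have lj : (j <= i)%N := leq_ord j.
  have lk : (k <= i - j)%N := leq_ord k.
  rewrite -subnDA [(j + k)%N]addnC subnDA subnK // leq_subRL.
    by rewrite addnC -leq_subRL.
  exact: leq_trans lk (leq_subr _ _).
rewrite (exchange_big_dep predT) //=; apply: eq_bigr => k _.
transitivity (\sum_(j < i.+1 | (j <= i - k)%N) coef3 j k).
  apply: eq_bigl => j; rewrite -ltnS -(ltnS j) -!subSn ?leq_ord //.
  by rewrite -subn_gt0 -(subn_gt0 j) -!subnDA addnC.
rewrite (big_ord_narrow_leq (leq_subr _ _)) tcoefM big_distrl /=.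
by apply: eq_bigr => j _; rewrite /coef3 -!subnDA addnC mulrA.
Qed.

Lemma tcoefCM c f i : tcoef (tmul (tconst c) f) i = c * tcoef f i.
Proof.
rewrite tcoefM big_ord_recl subn0 expn0 expr1 big1 => [|j _].
  by rewrite tcoefC addr0.
by rewrite tcoefC mul0r.
Qed.

Lemma tcoefMC f c i :
  tcoef (tmul f (tconst c)) i = tcoef f i * c ^+ (#|F| ^ i).
Proof.
rewrite tcoefMr big_ord_recl subn0 big1 => [|j _].
  by rewrite tcoefC addr0.
by rewrite tcoefC expr0q mulr0.
Qed.

Lemma tmul1f : left_id (tconst 1) tmul.
Proof. by move=> f; apply/tcoefP => i; rewrite tcoefCM mul1r. Qed.

Lemma tmulf1 : right_id (tconst 1) tmul.
Proof. by move=> f; apply/tcoefP => i; rewrite tcoefMC expr1n mulr1. Qed.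

Lemma tmulDl : left_distributive tmul +%R.
Proof.
move=> f g h; apply/tcoefP => i; rewrite tcoefD !tcoefM -big_split.
by apply: eq_bigr => j _; rewrite tcoefD mulrDl.
Qed.

Lemma tmulDr : right_distributive tmul +%R.
Proof.
move=> f g h; apply/tcoefP => i; rewrite tcoefD !tcoefM -big_split.
by apply: eq_bigr => j _; rewrite tcoefD exprDq mulrDr.
Qed.

Lemma tconst1_neq0 : tconst 1 != 0.
Proof. by rewrite /tconst polyC_eq0 oner_eq0. Qed.

HB.instance Definition _ := GRing.Zmodule_isNzRing.Build tpoly
  tmulA tmul1f tmulf1 tmulDl tmulDr tconst1_neq0.

Definition tscale (c : F) f : tpoly := tmul (tconst (embA c%:P)) f.

Lemma tcoefZ c f i : tcoef (tscale c f) i = embA c%:P * tcoef f i.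
Proof. exact: tcoefCM. Qed.

Lemma tscaleA a b f : tscale a (tscale b f) = tscale (a * b) f.
Proof.
by apply/tcoefP => i; rewrite !tcoefZ polyCM rmorphM mulrA.
Qed.

Lemma tscale1 : left_id 1 tscale.
Proof. by move=> f; apply/tcoefP => i; rewrite tcoefZ rmorph1 mul1r. Qed.

Lemma tscaleDr : right_distributive tscale +%R.
Proof.
by move=> a f g; apply/tcoefP => i; rewrite tcoefD !tcoefZ tcoefD mulrDr.
Qed.

Lemma tscaleDl f : {morph tscale^~ f : a b / a + b}.
Proof.
move=> a b; apply/tcoefP => i.
by rewrite tcoefD !tcoefZ polyCD rmorphD mulrDl.
Qed.

HB.instance Definition _ := GRing.Zmodule_isLmodule.Build F tpoly
  tscaleA tscale1 tscaleDr tscaleDl.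

Lemma tscaleAl (c : F) f g : c *: (f * g) = (c *: f) * g.
Proof. exact: tmulA. Qed.

HB.instance Definition _ := GRing.Lmodule_isLalgebra.Build F tpoly tscaleAl.

Lemma embA_expq (c : F) j : embA c%:P ^+ (#|F| ^ j) = embA c%:P.
Proof.
rewrite -!rmorphXn /=; congr (embA _%:P).
by elim: j => [|j IHj]; rewrite ?expr1 // expnSr exprM IHj expf_card.
Qed.

Lemma tscaleAr (c : F) f g : c *: (f * g) = f * (c *: g).
Proof.
apply/tcoefP => i; rewrite [LHS]tcoefZ [in LHS]tcoefM [RHS]tcoefM mulr_sumr.
by apply: eq_bigr => j _; rewrite tcoefZ exprMn embA_expq mulrCA.
Qed.

HB.instance Definition _ := GRing.Lalgebra_isAlgebra.Build F tpoly tscaleAr.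

Lemma tau_tconst (c : K) :
  ('X : tpoly) * tconst c = tconst (c ^+ #|F|) * ('X : tpoly).
Proof.
apply/tcoefP => i; rewrite [LHS]tcoefMC [RHS]tcoefCM /tcoef coefX.
by case: eqP => [->|_]; rewrite ?expn1 ?mul1r ?mulr1 ?mul0r ?mulr0.
Qed.

Record drinfeld_module := DrinfeldModule {
  drank : nat;
  drank_ge1 : (1 <= drank)%N;
  dmap :> {lrmorphism {poly F} -> tpoly};
  dmap_coef0 : forall a : {poly F}, tcoef (dmap a) 0 = embA a;
  dmap_deg : forall a : {poly F}, tdeg (dmap a) = (drank * (size a).-1)%N
}.

Definition isogeny (phi psi : drinfeld_module) f : Prop :=
  f != 0 /\ forall a : {poly F}, f * phi a = psi a * f.

Definition isogenous (phi psi : drinfeld_module) : Prop :=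
  exists f, isogeny phi psi f.

End Twisted.

(* The places of a field L, given by their normalized valuations
   L -> Z u {oo}; these take values in \bar int, with -oo excluded. *)
Record place (L : fieldType) := Place {
  ord :> L -> \bar int;
  ord_neqNy : forall x, ord x != -oo%E;
  ord_eqy : forall x, (ord x == +oo%E) = (x == 0);
  ordM : forall x y, ord (x * y) = (ord x + ord y)%E;
  ordD : forall x y, (Order.min (ord x) (ord y) <= ord (x + y)%R)%E;
  ord_onto : forall n : int, exists x, ord x = n%:E
}.

Section InftyPlace.

Fact div_neq0 (L : fieldType) (x y : L) : x != 0 -> y != 0 -> x / y != 0.
Proof. by move=> x0 y0; rewrite mulf_neq0 ?invr_eq0. Qed.

Local Open Scope quotient_scope.
#[local] Remove Hints denom_ratioP : core.

Variable F : finFieldType.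

Local Notation K0 := {fraction {poly F}}.
Local Notation "a %:F" := (@FracField.tofrac {poly F} a).

(* deg b - deg a for the fraction a / b; the two successors in
   size = deg + 1 cancel out *)
Definition ord_infty (x : K0) : \bar int :=
  if x == 0 then +oo%E
  else ((size \d_(repr x))%:Z - (size \n_(repr x))%:Z)%:E.

Fact size_neq0 (a : {poly F}) : a != 0 -> (0 < size a)%N.
Proof. by rewrite size_poly_gt0. Qed.

Fact frac_cross (R : idomainType) (L : fieldType) (i : {rmorphism R -> L})
    (a b n d : R) :
  (forall x y, (i x == i y) = (x == y)) -> a != 0 -> b != 0 -> d != 0 ->
  i a / i b * i d = i n -> n != 0 /\ n * b = a * d.
Proof.
move=> i_inj a0 b0 d0 E; have i0 x : (i x == 0) = (x == 0).
  by rewrite -(rmorph0 i) i_inj.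
split; last by apply/eqP; rewrite -i_inj !rmorphM /= -E mulrAC mulfVK ?i0.
by rewrite -i0 -E !mulf_neq0 ?invr_eq0 ?i0.
Qed.

Lemma frac_repr (x : K0) : x * (\d_(repr x))%:F = (\n_(repr x))%:F.
Proof.
rewrite -{1}[x]reprK; set r := repr x; unlock FracField.tofrac.
rewrite -[LHS]FracField.pi_mul; apply/eqmodP.
rewrite /= FracField.equivfE /FracField.mulf !numden_Ratio ?mulr1 ?oner_eq0 //.
  by rewrite mulrC.
all: by rewrite ?mulr1 ?oner_eq0 ?denom_ratioP.
Qed.

Lemma ord_infty0 : ord_infty 0 = +oo%E.
Proof. by rewrite /ord_infty eqxx. Qed.

Lemma ord_infty_div (a b : {poly F}) : a != 0 -> b != 0 ->
  ord_infty (a%:F / b%:F) = ((size b)%:Z - (size a)%:Z)%:E.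
Proof.
move=> a0 b0; set x := _ / _; have aF : a%:F != 0 by rewrite tofrac_eq0.
have bF : b%:F != 0 by rewrite tofrac_eq0.
have x0 : x != 0 := div_neq0 aF bF.
rewrite /ord_infty (negbTE x0); congr (_%:E).
have := frac_repr x; have := denom_ratioP (repr x).
move: (\n_(repr x)) (\d_(repr x)) => n d d0 xE.
have [n0 /(congr1 (fun p : {poly F} => size p))] :=
  frac_cross (@tofrac_eq _) a0 b0 d0 xE.
rewrite /= !size_mul //.
have {n0} := size_neq0 n0; have {d0} := size_neq0 d0.
have {a0} := size_neq0 a0; have {b0} := size_neq0 b0.
move: (size n) (size d) (size a) (size b).
clear; lia.
Qed.

(* ord_infty a = - deg a *)
Lemma ord_infty_poly (a : {poly F}) : a != 0 ->
  ord_infty a%:F = (- ((size a).-1)%:Z)%:E.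
Proof.
move=> a0; rewrite -[a%:F]divr1 -tofrac1 ord_infty_div ?oner_eq0 //.
congr (_%:E); rewrite size_poly1.
by move/size_neq0: a0; move: (size a); clear; lia.
Qed.

Variant frac_spec : K0 -> Prop :=
  | Frac0 : frac_spec 0
  | FracDiv a b of a != 0 & b != 0 : frac_spec (a%:F / b%:F).

Lemma fracP x : frac_spec x.
Proof.
have dF : (\d_(repr x))%:F != 0 by rewrite tofrac_eq0 denom_ratioP.
have xE : x = (\n_(repr x))%:F / (\d_(repr x))%:F by rewrite -frac_repr mulfK.
have [n0|n0] := eqVneq \n_(repr x) 0.
  by rewrite xE n0 rmorph0 mul0r; constructor.
by rewrite xE; constructor => //; apply: denom_ratioP.
Qed.

Lemma ord_infty_neqNy x : ord_infty x != -oo%E.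
Proof. by rewrite /ord_infty; case: ifP. Qed.

Lemma ord_infty_eqy x : (ord_infty x == +oo%E) = (x == 0).
Proof. by rewrite /ord_infty; case: ifP. Qed.

Lemma ord_inftyM x y : ord_infty (x * y) = (ord_infty x + ord_infty y)%E.
Proof.
case: (fracP x) => [|a b a0 b0].
  by rewrite mul0r ord_infty0; have := ord_infty_neqNy y; case: ord_infty.
case: (fracP y) => [|c d c0 d0]; first by rewrite mulr0 ord_infty0 ord_infty_div.
rewrite mulf_div -!tofracM !ord_infty_div ?mulf_neq0 // -EFinD.
congr (_%:E); rewrite !size_mul //.
have {c0} := size_neq0 c0; have {d0} := size_neq0 d0.
have {a0} := size_neq0 a0; have {b0} := size_neq0 b0.
move: (size a) (size b) (size c) (size d).
clear; lia.
Qed.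

Lemma ord_inftyD x y :
  (Order.min (ord_infty x) (ord_infty y) <= ord_infty (x + y)%R)%E.
Proof.
case: (fracP x) => [|a b a0 b0]; first by rewrite add0r ge_min lexx orbT.
case: (fracP y) => [|c d c0 d0]; first by rewrite addr0 ge_min lexx.
have [->|xy0] := eqVneq (a%:F / b%:F + c%:F / d%:F) 0.
  by rewrite ord_infty0 leey.
have xyE : a%:F / b%:F + c%:F / d%:F = (a * d + c * b)%:F / (b * d)%:F.
  by rewrite addf_div ?tofrac_eq0 // tofracD !tofracM.
have n0 : a * d + c * b != 0.
  by apply: contraNneq xy0 => n0; rewrite xyE n0 rmorph0 mul0r.
rewrite xyE !ord_infty_div ?mulf_neq0 // -EFin_min lee_fin.
have := size_polyD (a * d) (c * b); rewrite !size_mul //.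
have {c0} := size_neq0 c0; have {d0} := size_neq0 d0.
have {a0} := size_neq0 a0; have {b0} := size_neq0 b0.
rewrite ge_min.
move: (size a) (size b) (size c) (size d) (size (a * d + c * b)).
clear; lia.
Qed.

Lemma ord_infty_onto (n : int) : exists x, ord_infty x = n%:E.
Proof.
have X0 m : 'X^m != 0 :> {poly F} by rewrite -size_poly_eq0 size_polyXn.
exists ('X^(`|Num.min n 0|)%:F / 'X^(`|Num.max n 0|)%:F).
rewrite ord_infty_div // !size_polyXn; congr (_%:E); lia.
Qed.

Definition infty_place : place K0 :=
  Place ord_infty_neqNy ord_infty_eqy ord_inftyM ord_inftyD ord_infty_onto.

End InftyPlace.

Section Places.

Variables (F : finFieldType) (K : fieldExtType {fraction {poly F}}).

(* The restriction of ord_v to K_0 is a positive multiple of ord_w, the factor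
   being the ramification index of v over w. *)
Definition lies_above (v : place K) (w : place {fraction {poly F}}) : Prop :=
  exists e : nat, (0 < e)%N /\
    forall x : {fraction {poly F}}, v x%:A = (e%:Z%:E * w x)%E.

Definition infinite_place (v : place K) : Prop := lies_above v (infty_place F).

Definition finite_place (v : place K) : Prop := ~ infinite_place v.

(* The constant coefficient of c^-1 phi_T c is always T, so its other
   coefficients are the g_i. *)
Definition stable_reduction (phi : drinfeld_module K) (v : place K) : Prop :=
  exists c : K, c != 0 /\
    let g := tcoef (tconst (c^-1) * phi 'X * tconst c) in
    \big[Order.min/+oo%E]_(1 <= i < (drank phi).+1) v (g i) = 0%E.

End Places.

(* Main.v *)
(* Allow rational numbers a, b as "valuations" of scalars and say that h is
   dominant of type (a, b) and degree k if, for scalars l, m of valuations a, b,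
   the twisted polynomial l^-1 h m is integral and has a reduction of degree k.
   As in the residue ring, types compose and degrees add under products.  Some
   conjugate of phi has a reduction of positive degree, so phi_T has type (b, b)
   for a unique b, and phi has stable reduction exactly when b is an integer.
   Given f phi_T = psi_T f, the type (a, b) of f makes (a, a) the type of psi_T,
   with the same degree.  As a coefficient f_i has valuation a - q^i b, a is an
   integer if b is.  Conversely, if a is an integer then so is q^i b; so is
   (q^k - 1) b, since phi_T has a coefficient of valuation (1 - q^k) b with
   k > 0; hence b is an integer, because q^i and q^k - 1 are coprime. *)
Require Import Defs.
From mathcomp Require Import all_boot all_order all_algebra all_field.
From mathcomp Require Import constructive_ereal zify ring lra.

Set Implicit Arguments.
Unset Strict Implicit.
Unset Printing Implicit Defensive.

Import Order.TTheory GRing.Theory Num.Theory.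
Local Open Scope ring_scope.

(** * Rational-valued form of a place and its ultrametric inequality *)

Section Valuation.

Variables (L : fieldType) (v : place L).
Implicit Types (x y : L) (r s : rat).

(* 0 at x = 0, where the valuation is +oo *)
Definition ordq x : rat := (fine (v x))%:~R.

Lemma place_fin x : x != 0 -> v x = (fine (v x))%:E.
Proof.
by have := ord_neqNy v x; rewrite -(ord_eqy v); case: (v x).
Qed.

Lemma place0 : v 0 = +oo%E.
Proof. by apply/eqP; rewrite ord_eqy. Qed.

Lemma ordqM x y : x != 0 -> y != 0 -> ordq (x * y) = ordq x + ordq y.
Proof.
move=> x0 y0; rewrite /ordq ordM (place_fin x0) (place_fin y0) -EFinD /=.
by rewrite intrD.
Qed.

Lemma ordq1 : ordq 1 = 0.
Proof.
have := ordqM (oner_neq0 L) (oner_neq0 L); rewrite mulr1 => h; lra.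
Qed.

Lemma ordqX x n : x != 0 -> ordq (x ^+ n) = n%:R * ordq x.
Proof.
move=> x0; elim: n => [|n IHn]; first by rewrite expr0 ordq1 mul0r.
by rewrite exprS ordqM ?expf_neq0 // IHn -natr1; ring.
Qed.

Lemma ordqV x : x != 0 -> ordq x^-1 = - ordq x.
Proof.
move=> x0; have := ordqM x0 (invr_neq0 x0).
by rewrite divff // ordq1 => h; lra.
Qed.

Lemma ordqN x : ordq (- x) = ordq x.
Proof.
have [->|x0] := eqVneq x 0; first by rewrite oppr0.
have N1 : -1 != 0 :> L by rewrite oppr_eq0 oner_eq0.
have : ordq (-1) = 0.
  by have := ordqM N1 N1; rewrite mulrNN mulr1 ordq1 => h; lra.
by move=> h; rewrite -mulN1r ordqM // h add0r.
Qed.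

(** The disjunct [x == 0] stands for the infinite valuation of 0, where [ordq] takes a default
    value. *)
Definition vge r x := (x == 0) || (r <= ordq x).
Definition vgt r x := (x == 0) || (r < ordq x).

Lemma ordqD x y : x != 0 -> y != 0 -> x + y != 0 ->
  Num.min (ordq x) (ordq y) <= ordq (x + y).
Proof.
move=> x0 y0 xy0; have := ordD v x y; rewrite /ordq.
rewrite (place_fin x0) (place_fin y0) (place_fin xy0) /= -EFin_min lee_fin.
by rewrite !ge_min !ler_int.
Qed.

Lemma vgeD r x y : vge r x -> vge r y -> vge r (x + y).
Proof.
rewrite /vge; have [->|x0] := eqVneq x 0; first by rewrite add0r.
have [->|y0] := eqVneq y 0; first by rewrite addr0 (negbTE x0).
have [//|xy0] := eqVneq (x + y) 0; rewrite /= => rx ry.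
by apply: le_trans (ordqD x0 y0 xy0); rewrite le_min rx.
Qed.

Lemma vgtD r x y : vgt r x -> vgt r y -> vgt r (x + y).
Proof.
rewrite /vgt; have [->|x0] := eqVneq x 0; first by rewrite add0r.
have [->|y0] := eqVneq y 0; first by rewrite addr0 (negbTE x0).
have [//|xy0] := eqVneq (x + y) 0; rewrite /= => rx ry.
by apply: lt_le_trans (ordqD x0 y0 xy0); rewrite lt_min rx.
Qed.

Lemma vge_sum r (I : finType) (P : pred I) (u : I -> L) :
  (forall i, P i -> vge r (u i)) -> vge r (\sum_(i | P i) u i).
Proof.
move=> h; apply: (big_ind (vge r)) => //; last exact: vgeD.
by rewrite /vge eqxx.
Qed.

Lemma vgt_sum r (I : finType) (P : pred I) (u : I -> L) :
  (forall i, P i -> vgt r (u i)) -> vgt r (\sum_(i | P i) u i).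
Proof.
move=> h; apply: (big_ind (vgt r)) => //; last exact: vgtD.
by rewrite /vgt eqxx.
Qed.

Lemma ordqD_vgt x y : x != 0 -> vgt (ordq x) y ->
  x + y != 0 /\ ordq (x + y) = ordq x.
Proof.
move=> x0; rewrite /vgt.
have [->|y0 /= xy] := eqVneq y 0; first by rewrite addr0.
have xy0 : x + y != 0.
  apply: contraTneq xy => /eqP; rewrite addr_eq0 => /eqP ->.
  by rewrite ordqN ltxx.
split=> //; apply/eqP; rewrite eq_le; apply/andP; split; last first.
  by apply: le_trans (ordqD x0 y0 xy0); rewrite le_min lexx ltW.
(* The reverse inequality comes from x = (x + y) - y: as ord y exceeds ord x, the minimum must be
   ord (x + y). *)
have Ny0 : - y != 0 by rewrite oppr_eq0.
have := ordqD xy0 Ny0; rewrite addrK => /(_ x0).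
by rewrite ordqN ge_min => /orP[//|]; rewrite leNgt xy.
Qed.

Lemma vge_mul_exp r s x y n :
  vge r x -> vge s y -> (0 < n)%N -> vge (r + n%:R * s) (x * y ^+ n).
Proof.
move=> + + n0; rewrite /vge.
have [->|x0] := eqVneq x 0; first by rewrite mul0r eqxx.
have [->|y0] := eqVneq y 0; first by rewrite expr0n (gtn_eqF n0) mulr0 eqxx.
move=> /= rx sy; rewrite ordqM ?expf_neq0 // ordqX //.
by rewrite lerD ?orbT // ler_pM2l // ltr0n.
Qed.

Lemma vgt_mul_exp r s x y n :
  vge r x -> vge s y -> (0 < n)%N -> vgt r x || vgt s y ->
  vgt (r + n%:R * s) (x * y ^+ n).
Proof.
move=> + + n0; rewrite /vge /vgt.
have [->|x0] := eqVneq x 0; first by rewrite mul0r eqxx.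
have [->|y0] := eqVneq y 0; first by rewrite expr0n (gtn_eqF n0) mulr0 eqxx.
move=> /= rx sy; rewrite ordqM ?expf_neq0 // ordqX //.
have n0' : 0 < n%:R :> rat by rewrite ltr0n.
have := sy; rewrite -(ler_pM2l n0') => nsy.
case/orP => [lt|]; first by rewrite ltr_leD ?orbT.
by rewrite -(ltr_pM2l n0') => lt; rewrite ler_ltD ?orbT.
Qed.

Lemma place_ge0 x : (0 <= v x)%E = vge 0 x.
Proof.
rewrite /vge; have [->|x0] := eqVneq x 0; first by rewrite place0 leey.
by rewrite (place_fin x0) lee_fin /= -(@ler_int rat).
Qed.

Lemma place_eq0 x : v x = 0%E <-> x != 0 /\ ordq x = 0.
Proof.
split=> [vx|[x0 /eqP]]; last first.
  by rewrite /ordq intr_eq0 (place_fin x0) => /eqP /= ->.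
by rewrite /ordq vx; split=> //; rewrite -(ord_eqy v) vx.
Qed.

End Valuation.

(** * Dominant types of twisted polynomials *)

Section Dominant.

Variables (F : finFieldType) (K : fieldExtType {fraction {poly F}}).
Variable v : place K.
Implicit Types (f g h : tpoly K) (a b c : rat).

Local Notation q i := ((#|F| ^ i)%N%:R : rat).

Lemma ltq i j : (i < j)%N -> q i < q j.
Proof. by rewrite ltr_nat ltn_exp2l // finNzRing_gt1. Qed.

(* The coefficients of l^-1 h m, with l and m of valuations a and b, are all
   integral and the last one which is a unit has index k. As a and b are
   rational, l and m may only exist in a ramified extension of K. *)
Definition dominant a b h k :=
  [/\ tcoef h k != 0, ordq v (tcoef h k) = a - q k * b,
      forall i, vge v (a - q i * b) (tcoef h i) &
      forall i, (k < i)%N -> vgt v (a - q i * b) (tcoef h i)].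

(** The middle parameter b cancels: the term f_l g_(m-l)^(q^l) has valuation at least (a - q^l b) +
    q^l (b - q^(m-l) c) = a - q^m c, strictly more once l > i or m - l > j. For m = i + j only l = i
    escapes strictness; for m > i + j no term does. *)
Lemma dominantM a b c f g i j :
  dominant a b f i -> dominant b c g j -> dominant a c (f * g) (i + j).
Proof.
case=> fi0 fi fge fgt [gj0 gj gge ggt].
have wE (m : nat) (l : 'I_m.+1) :
    a - q m * c = a - q l * b + (#|F| ^ l)%:R * (b - q (m - l) * c).
  have -> : q m = q l * q (m - l).
    by rewrite -natrM -expnD subnKC // -ltnS.
  ring.
have strict (m : nat) (l : 'I_m.+1) : (i < l)%N || (j < m - l)%N ->
    vgt v (a - q m * c) (tcoef f l * tcoef g (m - l) ^+ (#|F| ^ l)).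
  move=> lt; rewrite (wE _ l); apply: vgt_mul_exp => //; first exact: expq_gt0.
  by case/orP: lt => [/fgt -> // | /ggt ->]; rewrite orbT.
have ilt : (i < (i + j).+1)%N by rewrite ltnS leq_addr.
have dom : tcoef (f * g) (i + j) != 0 /\
    ordq v (tcoef (f * g) (i + j)) = a - q (i + j) * c.
  rewrite tcoefM (bigD1 (Ordinal ilt)) //= addKn.
  have qi0 := expq_gt0 F i.
  have t0 : tcoef f i * tcoef g j ^+ (#|F| ^ i) != 0.
    by rewrite mulf_neq0 ?expf_neq0.
  have tE : ordq v (tcoef f i * tcoef g j ^+ (#|F| ^ i)) = a - q (i + j) * c.
    by rewrite ordqM ?expf_neq0 // ordqX // fi gj (wE _ (Ordinal ilt)) /= addKn.
  rewrite -tE; apply: ordqD_vgt => //; rewrite tE.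
  apply: vgt_sum => l; rewrite -val_eqE /= => li; apply: strict.
  have := ltn_ord l; move: li; move: (l : nat) => {}l; lia.
case: dom => n0 oE; split=> // m.
  rewrite tcoefM; apply: vge_sum => l _; rewrite (wE _ l).
  by apply: vge_mul_exp => //; exact: expq_gt0.
move=> km; rewrite tcoefM; apply: vgt_sum => l _; apply: strict.
have := ltn_ord l; move: (l : nat) => {}l; lia.
Qed.

Lemma dominant_le a a' b h k k' :
  dominant a b h k -> dominant a' b h k' -> a' <= a.
Proof.
move=> [hk0 hk _ _] [_ _ /(_ k) + _].
by rewrite /vge (negbTE hk0) hk /= => ?; lra.
Qed.

Lemma dominant_leq a b h k k' :
  dominant a b h k -> dominant a b h k' -> (k <= k')%N.
Proof.
move=> [hk0 hk _ _] [_ _ _ /(_ k) +].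
rewrite /vgt (negbTE hk0) hk ltxx /=.
by case: leqP => // _ /(_ isT).
Qed.

Lemma dominant_uniq a a' b h k k' :
  dominant a b h k -> dominant a' b h k' -> a = a' /\ k = k'.
Proof.
move=> hk hk'; have aa' : a = a'.
  by apply: le_anti; rewrite (dominant_le hk hk') (dominant_le hk' hk).
split=> //; move: hk hk'; rewrite aa' => hk hk'.
by apply/eqP; rewrite eqn_leq (dominant_leq hk hk') (dominant_leq hk' hk).
Qed.

(** The degree k is the largest index at which the bound is attained. *)
Lemma dominant_of_attained a b h j :
  tcoef h j != 0 -> ordq v (tcoef h j) = a - q j * b ->
  (forall i, vge v (a - q i * b) (tcoef h i)) ->
  exists2 k, (j <= k)%N & dominant a b h k.
Proof.
move=> hj0 hj hge.
pose P k := (tcoef h k != 0) && (ordq v (tcoef h k) == a - q k * b).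
have Pj : P j by rewrite /P hj0 hj eqxx.
have Pb k : P k -> (k <= size (h : {poly K}))%N.
  case/andP=> + _; apply: contraR; rewrite -ltnNge => lt.
  by rewrite /tcoef nth_default // ltnW.
have [k /andP[hk0 /eqP hk] kmax] := ex_maxnP (ex_intro _ j Pj) Pb.
exists k; first exact: kmax.
split=> // i ki; have := hge i; rewrite /vge /vgt.
have [//|hi0 /=] := eqVneq (tcoef h i) 0.
rewrite le_eqVlt => /orP[/eqP hi|//].
by have := kmax i; rewrite /P hi0 hi eqxx leqNgt ki => /(_ isT).
Qed.

(** For given b, the right a is the minimum of ord h_i + q^i b over the nonzero coefficients h_i;
    the leading coefficient makes this range nonempty. *)
Lemma dominant_exists b h : h != 0 -> exists a k, dominant a b h k.
Proof.
move=> h0; pose n := size (h : {poly K}).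
have n0 : (n.-1 < n)%N by rewrite prednK ?size_poly_gt0.
pose w (i : 'I_n) := ordq v (tcoef h i) + q i * b.
have lead0 : tcoef h (Ordinal n0) != 0.
  by rewrite /tcoef -/(lead_coef (h : {poly K})) lead_coef_eq0.
case: (@arg_minP _ _ _ (Ordinal n0) (fun i : 'I_n => tcoef h i != 0) w) => //.
move=> j hj0 jmin.
have [||k _ hk] := @dominant_of_attained (w j) b h j hj0.
- by rewrite /w; ring.
- move=> i; rewrite /vge; have [//|hi0 /=] := eqVneq (tcoef h i) 0.
  have [lt|ge] := ltnP i n; last by rewrite /tcoef nth_default ?eqxx in hi0.
  by have := jmin (Ordinal lt) hi0; rewrite /w /= => ?; lra.
by exists (w j), k.
Qed.

(** For b <= a, the coefficient of index j attains a - q^j a and is at least b - q^j b, so (q^j - 1)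
    (a - b) <= 0. Since j > 0, the first factor is positive. *)
Lemma dominant_conj_uniq a b h j k : (0 < j)%N -> (0 < k)%N ->
  dominant a a h j -> dominant b b h k -> a = b.
Proof.
wlog ab : a b j k / b <= a.
  move=> H j0 k0 hj hk; have [ba|/ltW ab] := leP b a; first exact: H hj hk.
  by rewrite (H _ _ _ _ ab k0 j0 hk hj).
move=> j0 _ [hj0 hj _ _] [_ _ /(_ j) + _].
rewrite /vge (negbTE hj0) hj /= => le.
have : (q j - 1) * (a - b) <= 0 by lra.
have q1 : 0 < q j - 1 by rewrite subr_gt0 -[1]/(q 0); exact: ltq.
by rewrite pmulr_rle0 // => ba; apply: le_anti; rewrite ab -subr_le0 ba.
Qed.

End Dominant.

(** * Integrality of T at finite places *)

Section Reduction.

Variables (F : finFieldType) (K : fieldExtType {fraction {poly F}}).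
Variable v : place K.
Implicit Types (f g h : tpoly K) (a b c : rat) (phi psi : drinfeld_module K).

Local Notation q i := ((#|F| ^ i)%N%:R : rat).
Local Notation ordA p := (ordq v (embA K p)).

(** Since c^q = c, the valuation is killed by q - 1. *)
Lemma ordq_const (c : F) : c != 0 -> ordA c%:P = 0.
Proof.
move=> c0; have C0 : embA K c%:P != 0 by rewrite embA_eq0 polyC_eq0.
have := embA_expq K c 1; move/(congr1 (ordq v)); rewrite ordqX // => /eqP.
rewrite -subr_eq0 -{2}[ordq _ _]mul1r -mulrBl mulf_eq0 => /orP[|/eqP //].
by rewrite subr_eq0 -[1]/(q 0) gt_eqF // ltq.
Qed.

(** When T has a pole, the leading term strictly dominates, constants having valuation 0. *)
Lemma ordq_embA (p : {poly F}) : ordA 'X < 0 -> p != 0 ->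
  ordA p = ((size p)%:R - 1) * ordA 'X.
Proof.
move=> T_lt0; have X0 : embA K 'X != 0 by rewrite embA_eq0 polyX_eq0.
elim/poly_ind: p => [|p c IHp]; first by rewrite eqxx.
have [->|p0] := eqVneq p 0.
  rewrite mul0r add0r polyC_eq0 => c0.
  by rewrite ordq_const // size_polyC c0 subrr mul0r.
have P0 : embA K p != 0 by rewrite embA_eq0.
move=> _; rewrite size_MXaddC (negbTE p0) /= -natr1 addrK rmorphD rmorphM /=.
have oE : ordq v (embA K p * embA K 'X) = (size p)%:R * ordA 'X.
  by rewrite ordqM // IHp //; ring.
rewrite -oE; apply: (proj2 (ordqD_vgt _ _)); first exact: mulf_neq0.
rewrite /vgt embA_eq0 polyC_eq0; have [//|c0 /=] := eqVneq c 0.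
by rewrite ordq_const // oE nmulr_llt0 // ltr0n size_neq0.
Qed.

(** If T had a pole at v, the valuation of a polynomial would depend only on its degree, and v would
    lie above the infinite place. *)
Lemma finite_place_ge0 : finite_place v -> 0 <= ordA 'X.
Proof.
move=> fin; rewrite leNgt; apply/negP => T_lt0; apply: fin.
set n := fine (v (embA K 'X)).
have nE : ordA 'X = n%:~R by [].
have n0 : n < 0 by move: T_lt0; rewrite nE ltrz0.
(* The ramification index is read off at T, where [ord_infty] is -1 and v is n < 0. *)
exists `|n|%N; split; first by rewrite absz_gt0 lt_eqF.
move=> x; case: (fracP x) => [|s t s0 t0].
  rewrite scale0r place0 /= ord_infty0 mulry gtr0_sg ?mul1e //.
  by rewrite ltz_nat absz_gt0 lt_eqF.
have S0 : embA K s != 0 by rewrite embA_eq0.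
have T0 : embA K t != 0 by rewrite embA_eq0.
have -> : (FracField.tofrac s / FracField.tofrac t)%:A = embA K s / embA K t.
  apply: (mulIf T0); rewrite mulfVK // /embA -scalerAl mul1r scalerA.
  by rewrite mulfVK ?tofrac_eq0.
have oE : ordq v (embA K s / embA K t) =
    ((size s)%:R - (size t)%:R) * ordA 'X.
  rewrite (ordqM _ S0 (invr_neq0 T0)) (ordqV _ T0).
  by rewrite (ordq_embA T_lt0 s0) (ordq_embA T_lt0 t0); ring.
rewrite /= ord_infty_div // (place_fin _ (mulf_neq0 S0 (invr_neq0 T0))).
rewrite -EFinM; congr (_%:E); apply/eqP; rewrite -(eqr_int rat) -/(ordq v _) oE.
rewrite nE !intrM intrB abszE ltr0_norm // mulrNz; apply/eqP; ring.
Qed.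

(** * Dominant types of Drinfeld modules and isogenies *)

Lemma drinfeld_size phi : size (phi 'X : {poly K}) = (drank phi).+1.
Proof.
have := dmap_deg phi 'X; rewrite size_polyX muln1 /tdeg => sE.
by have := drank_ge1 phi; rewrite -sE; case: (size _).
Qed.

Lemma drinfeld_lead phi : tcoef (phi 'X) (drank phi) != 0.
Proof.
have := drinfeld_size phi; rewrite /tcoef => s.
have -> : drank phi = (size (phi 'X : {poly K})).-1 by rewrite s.
by rewrite -/(lead_coef _) lead_coef_eq0 -size_poly_eq0 s.
Qed.

(** With (c, a) the type of psi_T and k its degree, f phi_T has type (a, b) and degree i + j, while
    psi_T f has type (c, b) and degree k + i. Uniqueness of types gives c = a and k = j. *)
Lemma dominant_isogeny phi psi f b j : isogeny phi psi f -> (0 < j)%N ->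
  dominant v b b (phi 'X) j ->
  exists a i, dominant v a b f i /\ dominant v a a (psi 'X) j.
Proof.
move=> [f0 comm] j0 dphi.
have [a [i df]] := dominant_exists v b f0.
have psi0 : psi 'X != 0.
  by apply: contraNneq (drinfeld_lead psi) => ->; rewrite /tcoef coef0.
have [c [k dpsi]] := dominant_exists v a psi0.
exists a, i; split=> //.
have := dominantM dpsi df.
rewrite -comm => /(dominant_uniq (dominantM df dphi)).
by case=> ac /eqP; rewrite addnC eqn_add2r => /eqP ->; rewrite {1}ac.
Qed.

Lemma drinfeld_coef_le phi i : tcoef (phi 'X) i != 0 -> (i <= drank phi)%N.
Proof.
apply: contraR; rewrite -ltnNge => lt.
by rewrite /tcoef nth_default // drinfeld_size.
Qed.

(** At index 0 the bound b - q^0 b is 0, so the constant coefficient T meets it exactly because T is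
    integral at v. *)
Lemma drinfeld_dominant_of_attained phi b j : 0 <= ordA 'X -> (0 < j)%N ->
  tcoef (phi 'X) j != 0 -> ordq v (tcoef (phi 'X) j) = b - q j * b ->
  (forall i, (0 < i)%N -> vge v (b - q i * b) (tcoef (phi 'X) i)) ->
  exists2 k, (0 < k)%N & dominant v b b (phi 'X) k.
Proof.
move=> T_ge0 j0 gj0 gj gge.
have [|k jk dk] := dominant_of_attained gj0 gj.
  case=> [|i]; last exact: gge.
  by rewrite dmap_coef0 /vge expn0 mul1r subrr T_ge0 orbT.
by exists k => //; apply: leq_trans jk.
Qed.

(** The bound ord g_i >= b - q^i b amounts to b >= - ord g_i / (q^i - 1). Hence b is the maximum of
    these slopes over i > 0 with g_i nonzero, and is attained. *)
Lemma drinfeld_dominant phi : 0 <= ordA 'X ->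
  exists b, exists2 k, (0 < k)%N & dominant v b b (phi 'X) k.
Proof.
move=> T_ge0; pose r := drank phi; pose g := tcoef (phi 'X).
pose w (i : 'I_r.+1) := - ordq v (g i) / (q i - 1).
have q1 i : (0 < i)%N -> 0 < q i - 1.
  by move=> i0; rewrite subr_gt0 -[1]/(q 0); exact: ltq.
pose P (i : 'I_r.+1) := (0 < i)%N && (g i != 0).
have Pr : P ord_max by rewrite /P /= drank_ge1 drinfeld_lead.
case: (arg_maxP w Pr) => j /andP[j0 gj0] jmax.
exists (w j); apply: (@drinfeld_dominant_of_attained _ _ j) => //.
  by rewrite /w; field; rewrite gt_eqF ?q1.
move=> i i0; rewrite /vge; have [//|gi0 /=] := eqVneq (tcoef (phi 'X) i) 0.
have ir : (i < r.+1)%N by rewrite ltnS drinfeld_coef_le.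
have := jmax (Ordinal ir); rewrite /P /= i0 gi0 => /(_ isT).
rewrite /w /= ler_pdivrMr ?q1 // => ?; lra.
Qed.

(** * Stable reduction as an integral dominant type *)

Lemma ordq_conj x y n : x != 0 -> y != 0 ->
  ordq v (y^-1 * x * y ^+ n) = ordq v x - ordq v y + n%:R * ordq v y.
Proof.
move=> x0 y0; rewrite !ordqM ?ordqV ?ordqX ?mulf_neq0 ?expf_neq0 ?invr_eq0 //.
ring.
Qed.

Lemma bigmin_nat_eq0 (u : nat -> \bar int) r :
  \big[Order.min/+oo%E]_(1 <= i < r.+1) u i = 0%E <->
  (forall i, (0 < i <= r)%N -> (0 <= u i)%E) /\
  (exists2 i, (0 < i <= r)%N & u i = 0%E).
Proof.
split=> [min0|[u_ge0 [i ir ui0]]]; last first.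
  apply: le_anti; apply/andP; split.
    by apply: (@bigmin_inf_seq _ _ _ _ _ i); rewrite ?mem_index_iota ?ui0.
  by rewrite big_seq_cond; apply: le_bigmin => [|k]; rewrite ?leey //
    andbT mem_index_iota; exact: u_ge0.
split=> [i ir|].
  by rewrite -min0; apply: ge_bigmin_seq; rewrite ?mem_index_iota.
(* The default value +oo is not 0, so a minimum equal to 0 must be one of the terms. *)
have : has (fun i => u i == 0%E) (index_iota 1 r.+1).
  rewrite -[has _ _]negbK -all_predC; apply/negP => /allP u0.
  have : \big[Order.min/+oo%E]_(1 <= i < r.+1) u i != 0%E.
    rewrite big_seq; apply: (big_ind (fun x => x != 0%E)) => // x y x0 y0.
    by rewrite /Order.min; case: ifP.
  by rewrite min0 eqxx.
by case/hasP=> i; rewrite mem_index_iota => ir /eqP; exists i.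
Qed.

(** If c has valuation n, conjugation by c lowers ord g_i by n - q^i n, which turns the bound for
    the type (n, n) into 0. Conversely every integer n is the valuation of some c. *)
Lemma stable_reductionP phi : 0 <= ordA 'X ->
  stable_reduction phi v <->
  exists n : int, exists2 j, (0 < j)%N & dominant v n%:~R n%:~R (phi 'X) j.
Proof.
move=> T_ge0.
have gE (x : K) i : tcoef (tconst x^-1 * phi 'X * tconst x) i =
    x^-1 * tcoef (phi 'X) i * x ^+ (#|F| ^ i).
  by rewrite [LHS]tcoefMC tcoefCM.
split=> [[c [c0 /bigmin_nat_eq0[ge0 [j /andP[j0 jr]]]]]|].
  rewrite gE => /place_eq0[+ gj].
  rewrite !mulf_eq0 !negb_or => /andP[/andP[_ gj0] _].
  exists (fine (v c)); rewrite -/(ordq v c).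
  apply: (drinfeld_dominant_of_attained _ j0) => //.
    by move: gj; rewrite ordq_conj // => ?; lra.
  move=> i i0; rewrite /vge; have [//|gi0 /=] := eqVneq (tcoef (phi 'X) i) 0.
  have := ge0 i; rewrite i0 drinfeld_coef_le // gE place_ge0 => /(_ isT).
  rewrite /vge !mulf_eq0 expf_eq0 invr_eq0 (negbTE c0) (negbTE gi0) andbF /=.
  by rewrite ordq_conj // => ?; lra.
case=> n [j j0 [gj0 gj gge _]].
have [c cE] := ord_onto v n.
have c0 : c != 0 by rewrite -(ord_eqy v) cE.
have oc : ordq v c = n%:~R by rewrite /ordq cE.
exists c; split=> //; apply/bigmin_nat_eq0; split=> [i /andP[i0 ir]|].
  rewrite gE place_ge0 /vge; have := gge i; rewrite /vge.
  have [->|gi0 /= le] := eqVneq (tcoef (phi 'X) i) 0.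
    by rewrite mulr0 mul0r eqxx.
  by apply/orP; right; rewrite ordq_conj // oc; lra.
exists j; first by rewrite j0 drinfeld_coef_le.
apply/place_eq0; rewrite gE; split.
  by rewrite !mulf_neq0 ?expf_neq0 ?invr_eq0.
by rewrite ordq_conj // oc; lra.
Qed.

End Reduction.

(** * Integrality of the type and conclusion *)

Lemma int_of_coprime (x : rat) (m n : nat) : coprime m n -> (0 < m)%N ->
  m%:R * x \is a Num.int -> n%:R * x \is a Num.int -> x \is a Num.int.
Proof.
move=> mn m0 mx nx; case: (egcdnP n m0) => km kn e _.
have /(congr1 (fun k => k%:R : rat)) : (km * m = kn * n + 1)%N.
  by rewrite e; move: mn; rewrite /coprime => /eqP ->.
rewrite natrD !natrM => E.
(* Bézout: [km * m - kn * n = 1]. *)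
have -> : x = km%:R * (m%:R * x) - kn%:R * (n%:R * x).
  by rewrite !mulrA -mulrBl E; ring.
by rewrite rpredB // rpredM // natr_int.
Qed.

Theorem proposition4p10 (F : finFieldType)
    (K : fieldExtType {fraction {poly F}}) (phi psi : drinfeld_module K)
    (v : place K) :
  isogenous phi psi -> finite_place v ->
  (stable_reduction phi v <-> stable_reduction psi v).
Proof.
move=> [f iso] /finite_place_ge0 T_ge0.
have ordq_int x : ordq v x \is a Num.int by exact: intr_int.
split; case/(stable_reductionP _ T_ge0) => n [j j0 dn];
  apply/(stable_reductionP _ T_ge0).
  have [a [i [[_ fi _ _] da]]] := dominant_isogeny iso j0 dn.
  have /intrP[m am] : a \is a Num.int.
    have -> : a = ordq v (tcoef f i) + (#|F| ^ i)%N%:R * n%:~R.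
      by rewrite fi; ring.
    by rewrite rpredD // rpredM ?intr_int ?natr_int.
  by exists m; exists j; rewrite -?am.
have [b [k k0 db]] := drinfeld_dominant phi T_ge0.
have [a [i [[_ fi _ _] da]]] := dominant_isogeny iso k0 db.
(* Both (a, a) and (n, n) are types of psi_T with positive degree, so a = n is an integer. *)
have an := dominant_conj_uniq k0 j0 da dn; case: (db) => _ gk _ _.
have /intrP[m bm] : b \is a Num.int.
  apply: (@int_of_coprime _ (#|F| ^ i) (#|F| ^ k - 1)).
  - have q0 := expq_gt0 F.
    (* For i = 0 the power is 1. Otherwise q^i may be replaced by q, then by q^k, which is coprime
       to its predecessor. *)
    case: i {fi} => [|i]; first by rewrite coprime1n.
    rewrite coprime_pexpl // -(coprime_pexpl (k := k)) // coprime_sym.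
    by rewrite -[X in coprime _ X](subnK (q0 k)) addn1 coprimenS.
  - exact: expq_gt0.
  - have -> : (#|F| ^ i)%N%:R * b = n%:~R - ordq v (tcoef f i).
      by rewrite fi an; ring.
    by rewrite rpredB ?intr_int.
  have -> : (#|F| ^ k - 1)%N%:R * b = - ordq v (tcoef (phi 'X) k).
    by rewrite gk natrB ?expq_gt0 //; ring.
  by rewrite rpredN.
by exists m; exists k; rewrite -?bm.
Qed.
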